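(* Let $G$ be a cluster graph and $k,\eta$ non-negative integers. If there exists $F\subseteq\binom{V(G)}{2}\setminus E(G)$ with $|F|\le k$ such that $G+F$ is an $\eta$-balanced cluster graph, then either $G$ is $\eta$-balanced, or there exist an integer $\ell\in[2k]\setminus\{1\}$, a partition $X=\{x_1,\dots,x_t\}$ of $\ell$, and partitions $X_1,\dots,X_t$ with $X_i$ a partition of $x_i$ for each $i\in[t]$, such that: (1) the multiset $X'=\bigcup_{i\in[t]}X_i$ is $G$-valid; (2) $\sum_{i\in[t]}\mathrm{spp}(X_i)\le k$; and (3) some completion of $G$ with respect to $(X,\{X_1,\dots,X_t\})$ is $\eta$-balanced.
   Context: A cluster graph is a graph in which every connected component is a clique; for a non-negative integer $\eta$, a graph is $\eta$-balanced if any two connected components differ in number of vertices by at most $\eta$. $G+F$ denotes $(V(G),E(G)\cup F)$. A partition of a positive integer is a multiset of positive integers summing to it; the union of multisets is additive (multiplicities add). For a partition $Y=\{y_1,\dots,y_q\}$, $\mathrm{spp}(Y)=0$ if $q=1$ and otherwise $\mathrm{spp}(Y)=\sum_{1\le i<j\le q}y_iy_j$ (sum of products over unordered pairs of elements). A partition $\{z_1,\dots,z_r\}$ is $G$-valid if $G$ has $r$ distinct components $C_1,\dots,C_r$ with $|V(C_i)|=z_i$. Given $X=\{x_1,\dots,x_t\}$ and partitions $X_i=\{x_{i1},\dots,x_{ir_i}\}$ of $x_i$ with $\bigcup_iX_i$ $G$-valid, a completion of $G$ with respect to $(X,\{X_1,\dots,X_t\})$ is obtained by choosing pairwise distinct components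 $G_{ij}$ ($i\in[t]$, $j\in[r_i]$) of $G$ with $|V(G_{ij})|=x_{ij}$ and, for each $i\in[t]$, adding all edges needed to make $\bigcup_{j\in[r_i]}V(G_{ij})$ a clique. *)

(* Defs.v *)
From mathcomp Require Import all_boot.

Set Implicit Arguments.
Unset Strict Implicit.
Unset Printing Implicit Defensive.

(* A finite simple graph on the vertex set T is given by its adjacency
   relation e : rel T, assumed symmetric and irreflexive where needed. *)

Section Graphs.
Variable T : finType.
Implicit Types (e : rel T) (A C D : {set T}) (F : {set {set T}}).

Definition components e : {set {set T}} :=
  [set [set y | connect e x y] | x : T].

Definition clique e A : Prop := {in A &, forall x y, x != y -> e x y}.

Definition cluster_graph e : Prop := {in components e, forall C, clique e C}.

(* C and D range over ordered pairs, so this bounds the absolute difference. *)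
Definition balanced (eta : nat) e : Prop :=
  {in components e &, forall C D, #|C| <= #|D| + eta}.

Definition vertex_pairs : {set {set T}} := [set A : {set T} | #|A| == 2].

Definition edges e : {set {set T}} :=
  [set [set x; y] | x in T, y in T & e x y].

Definition add_edges e F : rel T :=
  [rel x y | e x y || ([set x; y] \in F)].

End Graphs.

(* Multisets of integers are enumerated as lists; additive union is then
   concatenation (flatten). All notions below are invariant under permutation
   of the lists; see perm_spp and perm_Gvalid. *)

Definition is_partition (n : nat) (Y : seq nat) : bool :=
  [&& 0 < n, all (leq 1) Y & sumn Y == n].

(* The sum is empty when Y has a single element. *)
Definition spp (Y : seq nat) : nat :=
  \sum_(i < size Y) \sum_(j < size Y | i < j) nth 0 Y i * nth 0 Y j.

Definition Gvalid (T : finType) (e : rel T) (Z : seq nat) : Prop :=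
  exists C : seq {set T},
    [/\ uniq C, {subset C <= components e} & [seq #|A| | A : {set T} <- C] = Z].

Definition partition_family (X : seq nat) (Xs : seq (seq nat)) : Prop :=
  size Xs = size X /\
  forall i, i < size X -> is_partition (nth 0 X i) (nth [::] Xs i).

(* The j-th entry of the i-th list of Gs is the component G_ij. *)
Definition merge_components (T : finType) (e : rel T)
    (Gs : seq (seq {set T})) : rel T :=
  [rel x y | e x y ||
     (x != y) && has (fun Gi => let U := \bigcup_(A <- Gi) A in
                                (x \in U) && (y \in U)) Gs].

Definition is_completion (T : finType) (e : rel T)
    (X : seq nat) (Xs : seq (seq nat)) (H : rel T) : Prop :=
  [/\ partition_family X Xs,
      Gvalid e (flatten Xs) &
      exists Gs : seq (seq {set T}),
        [/\ uniq (flatten Gs), {subset flatten Gs <= components e},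
            [seq [seq #|A| | A : {set T} <- Gi] | Gi <- Gs] = Xs
          & H =2 merge_components e Gs]].

Lemma spp_cons y Y : spp (y :: Y) = y * sumn Y + spp Y.
Proof.
rewrite /spp big_ord_recl; congr (_ + _); last first.
  by apply: eq_bigr => i _; rewrite big_mkcond big_ord_recl /= add0n -big_mkcond.
rewrite big_mkcond big_ord_recl /= add0n sumnE (big_nth 0) big_mkord big_distrr.
by [].
Qed.

Lemma spp_sqr Y : (spp Y).*2 + sumn [seq y ^ 2 | y <- Y] = sumn Y ^ 2.
Proof.
elim: Y => [|y Y IH]; first by rewrite /spp /= big_ord0.
by rewrite spp_cons /= sqrnD -IH doubleD -addnA addnC (addnCA (spp Y).*2) mul2n.
Qed.

Lemma perm_spp Y Y' : perm_eq Y Y' -> spp Y = spp Y'.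
Proof.
move=> eqY; apply: double_inj.
apply: (@addIn (sumn [seq y ^ 2 | y <- Y])); rewrite spp_sqr.
by rewrite (perm_sumn eqY) (perm_sumn (perm_map _ eqY)) spp_sqr.
Qed.

Lemma perm_Gvalid (T : finType) (e : rel T) Z Z' :
  perm_eq Z Z' -> Gvalid e Z -> Gvalid e Z'.
Proof.
move=> eqZ [C [uC sC defZ]].
have /(perm_iotaP 0)[Is pIs ->] : perm_eq Z' [seq #|A| | A : {set T} <- C].
  by rewrite defZ perm_sym.
rewrite size_map in pIs.
have pC : perm_eq [seq nth set0 C i | i <- Is] C.
  by apply/(perm_iotaP set0); exists Is.
exists [seq nth set0 C i | i <- Is]; split; first by rewrite (perm_uniq pC).
  by move=> A; rewrite (perm_mem pC); apply: sC.
rewrite -map_comp; apply/eq_in_map => i.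
by rewrite (perm_mem pIs) mem_iota /= => ltiC; rewrite (nth_map set0).
Qed.

(* Main.v *)
Require Import Defs.
From mathcomp Require Import all_boot.

(** Each component of [G + F] is a union of components of [G]; merge exactly
    the components of [G] lying in a component of [G + F] that is not already
    one of [G].  The resulting completion is [G + F] itself.  Every pair of
    vertices from distinct components merged together lies in [F], so the total
    [spp] is at most [#|F|]; and a partition with at least two parts has sum at
    most twice its [spp], whence [l <= 2 * k].  If nothing is merged, [G] and
    [G + F] have the same components. *)

(** The first part [y] and the sum [s] of the others are both positive, so [y + s <= 2 * (y * s)],
    and [y * s] is one summand of [spp]. With a single part [spp] is 0 and the bound fails. *)
Lemma sumn_le_double_spp (Y : seq nat) :
  1 < size Y -> all (leq 1) Y -> sumn Y <= 2 * spp Y.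
Proof.
case: Y => [|y [|z Y]] //= _ /and3P[y_gt0 z_gt0 _].
rewrite spp_cons mulnDr -[leqLHS]addn0 leq_add // mul2n -addnn.
by apply: leq_add; [apply: leq_pmulr | apply: leq_pmull]; rewrite //= addn_gt0 z_gt0.
Qed.

(** * Disjointness of components and counting of cross pairs *)

Section Components.
Variables (T : finType) (e : rel T).
Hypothesis e_sym : symmetric e.
Implicit Types (x y : T) (A B C D : {set T}).

Lemma component_of x : [set y | connect e x y] \in components e.
Proof. exact: imset_f. Qed.

Lemma componentE C x :
  C \in components e -> x \in C -> C = [set y | connect e x y].
Proof.
have csym := sym_connect_sym e_sym.
case/imsetP=> z _ ->; rewrite inE => zx; apply/setP=> y; rewrite !inE.
exact: same_connect.
Qed.

Lemma component_inj A B x :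
  A \in components e -> B \in components e -> x \in A -> x \in B -> A = B.
Proof. by move=> hA hB xA xB; rewrite (componentE _ _ hA xA) (componentE _ _ hB xB). Qed.

Lemma component_edge C x y :
  C \in components e -> x \in C -> e x y -> y \in C.
Proof. by move=> hC xC exy; rewrite (componentE _ _ hC xC) inE connect1. Qed.

Lemma component_gt0 C : C \in components e -> 0 < #|C|.
Proof. by case/imsetP=> x _ ->; apply/card_gt0P; exists x; rewrite inE. Qed.

Lemma notin_bigcup_components A (s : seq {set T}) x :
  A \in components e -> {subset s <= components e} -> A \notin s ->
  x \in A -> x \notin \bigcup_(B <- s) B.
Proof.
move=> hA hs As xA; apply/negP; rewrite bigcup_seq => /bigcupP[B Bs xB].
by move: As; rewrite (component_inj _ _ _ hA (hs _ Bs) xA xB) Bs.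
Qed.

Lemma card_bigcup_components (s : seq {set T}) :
  uniq s -> {subset s <= components e} ->
  #|\bigcup_(A <- s) A| = sumn [seq #|A| | A : {set T} <- s].
Proof.
elim: s => [|A s IH] /=; first by rewrite big_nil cards0.
case/andP=> As us hs; have hA := hs A (mem_head _ _).
have hs' : {subset s <= components e} by move=> B Bs; rewrite hs ?inE ?Bs ?orbT.
rewrite big_cons cardsU -IH //.
suff -> : A :&: \bigcup_(B <- s) B = set0 by rewrite cards0 subn0.
apply/setP=> x; rewrite !inE; apply/andP=> -[xA].
by apply/negP/(notin_bigcup_components A).
Qed.

(** Induction on [s]: the pairs joining the head [A] to the union [U] of the tail number
    [#|A| * #|U|], all belong to [F], and none of them lies inside [U], where the pairs of the tail
    are counted. *)
Lemma spp_le_cross_pairs (F : {set {set T}}) (s : seq {set T}) :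
  uniq s -> {subset s <= components e} ->
  (forall A B x y, A \in s -> B \in s -> A != B ->
     x \in A -> y \in B -> [set x; y] \in F) ->
  spp [seq #|A| | A : {set T} <- s] <=
    #|[set f in F | f \subset \bigcup_(A <- s) A]|.
Proof.
elim: s => [|A s IH] /=; first by rewrite /spp big_ord0.
case/andP=> As us hs hF; have hA := hs A (mem_head _ _).
have hs' : {subset s <= components e} by move=> B Bs; rewrite hs ?inE ?Bs ?orbT.
rewrite spp_cons -card_bigcup_components // big_cons.
set U := \bigcup_(B <- s) B.
have notU x : x \in A -> x \notin U by apply: notin_bigcup_components.
pose P := [set [set p.1; p.2] | p in setX A U].
(* As [A] and [U] are disjoint, an unordered pair in [P] determines which of its endpoints is in
   [A]. *)
have cardP : #|P| = #|A| * #|U|.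
  rewrite card_in_imset ?cardsX // => -[x y] [x' y'] /setXP[/= xA yU] /setXP[/= x'A y'U].
  move=> E.
  have := set21 x y; rewrite E => /set2P[->|xy']; last first.
    by move: (notU _ xA); rewrite xy' y'U.
  have := set22 x y; rewrite E => /set2P[yx'|-> //].
  by move: (notU _ x'A); rewrite -yx' yU.
have {}IH : spp [seq #|B| | B : {set T} <- s] <= #|[set f in F | f \subset U]|.
  by apply: IH => // B C x y Bs Cs; apply: hF; rewrite inE ?Bs ?Cs orbT.
rewrite -cardP; apply: leq_trans (leq_add (leqnn _) IH) _.
have dPF : [disjoint P & [set f in F | f \subset U]].
  rewrite -setI_eq0; apply/eqP/setP=> f; rewrite !inE; apply/negP=> /and3P[].
  case/imsetP=> -[x y] /setXP[/= xA yU] -> _ /subsetP/(_ _ (set21 x y)) xU.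
  by move: (notU _ xA); rewrite xU.
(* Disjointness is the equality case of [leq_card_setU], so the sum becomes the size of a union. *)
have [_ /esym] := leq_card_setU P [set f in F | f \subset U].
rewrite dPF => /esym/eqP <-.
apply/subset_leq_card/subsetP=> f /setUP[]; last first.
  by rewrite !inE => /andP[-> /subset_trans->] //; apply: subsetUr.
case/imsetP=> -[x y] /setXP[/= xA yU] ->; rewrite inE.
have /bigcupP[B Bs yB] : y \in \bigcup_(B in s) B by rewrite -bigcup_seq.
apply/andP; split.
  apply: (hF A B) => //; rewrite ?inE ?eqxx ?Bs ?orbT //.
  by apply: contraNneq As => ->.
by apply/subsetP=> z /set2P[]->; rewrite inE ?xA ?yU ?orbT.
Qed.

Definition components_in D : seq {set T} :=
  enum [set C in components e | C \subset D].

Lemma mem_components_in C D :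
  (C \in components_in D) = (C \in components e) && (C \subset D).
Proof. by rewrite mem_enum inE. Qed.

Lemma components_in_uniq D : uniq (components_in D).
Proof. exact: enum_uniq. Qed.

Lemma components_in_sub D : {subset components_in D <= components e}.
Proof. by move=> C; rewrite mem_components_in => /andP[]. Qed.

End Components.

Arguments components_in {T} e D.

(** * Components of a graph inside those of a supergraph *)

Section Supergraph.
Variables (T : finType) (e e' : rel T).
Hypotheses (e_sym : symmetric e) (e'_sym : symmetric e') (sub_e : subrel e e').
Implicit Types (x y : T) (C D : {set T}).

Lemma sub_component D x : D \in components e' -> x \in D ->
  [set y | connect e x y] \in components_in e D.
Proof.
move=> hD xD; rewrite mem_components_in component_of /=.
apply/subsetP=> y; rewrite (componentE _ _ e'_sym _ _ hD xD) !inE.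
by apply: connect_sub => u v /sub_e; apply: connect1.
Qed.

Lemma bigcup_components_in D :
  D \in components e' -> \bigcup_(C <- components_in e D) C = D.
Proof.
move=> hD; apply/setP=> x; rewrite bigcup_seq; apply/bigcupP/idP.
  by case=> C; rewrite mem_components_in => /andP[_ /subsetP]; apply.
by move=> xD; exists [set y | connect e x y]; rewrite ?sub_component // inE.
Qed.

Lemma sumn_components_in D : D \in components e' ->
  sumn [seq #|C| | C : {set T} <- components_in e D] = #|D|.
Proof.
move=> hD; rewrite -(card_bigcup_components _ e) ?bigcup_components_in //.
  exact: components_in_uniq.
exact: components_in_sub.
Qed.

(** The component [C] of [e] through a vertex of [D] is proper in [D]; a vertex of [D] outside [C]
    yields a second one. *)
Lemma size_components_in D : D \in components e' -> D \notin components e ->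
  1 < size (components_in e D).
Proof.
move=> hD nD; rewrite -cardE; apply/card_gt1P.
have /card_gt0P[x xD] := component_gt0 _ _ _ hD.
have := sub_component _ _ hD xD; set C := [set y | _] => hC.
move: (hC); rewrite mem_components_in => /andP[hCe sCD].
have /subsetPn[y yD yC] : ~~ (D \subset C).
  apply: contra nD => sDC; suff -> : D = C by [].
  by apply/eqP; rewrite eqEsubset sDC.
exists C, [set z | connect e y z]; split; try by rewrite -mem_enum ?sub_component.
by apply: contraNneq yC => ->; rewrite inE.
Qed.

(** One inclusion suffices: a component of [e] meets some component of [e'], which is also one of
    [e], so the two coincide. *)
Lemma balanced_same_components eta :
  {subset components e' <= components e} -> balanced eta e' -> balanced eta e.
Proof.
move=> sub; suff sub' : {subset components e <= components e'}.
  by move=> bal C D /sub' hC /sub' hD; apply: bal.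
move=> C hC; have /card_gt0P[x xC] := component_gt0 _ _ _ hC.
have hD := component_of _ e' x.
by rewrite (component_inj _ _ e_sym _ _ x hC (sub _ hD)) // inE.
Qed.

(** Unchanged components are excluded: each would form a group with one part, adding to [l] but
    nothing to the total [spp]. *)
Definition merged_components : seq {set T} :=
  enum (components e' :\: components e).

Definition merged_groups : seq (seq {set T}) :=
  [seq components_in e D | D <- merged_components].

Lemma mem_merged_components D :
  (D \in merged_components) = (D \notin components e) && (D \in components e').
Proof. by rewrite mem_enum inE. Qed.

Lemma merged_groups_uniq : uniq (flatten merged_groups).
Proof.
(* The identity map gives the list the shape expected by [allpairs_uniq_dep]. *)
have -> : merged_groups =
    [seq [seq C | C <- components_in e D] | D <- merged_components].
  by apply: eq_map => D; rewrite map_id.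
apply: allpairs_uniq_dep; first exact: enum_uniq.
  by move=> D _; apply: components_in_uniq.
move=> _ _ /allpairsPdep[D [C [hD hC ->]]] /allpairsPdep[D' [C' [hD' hC' ->]]] /=.
move=> eqC; rewrite -{}eqC in hC' *; suff -> : D = D' by [].
move: hC hC' hD hD'; rewrite !mem_components_in !mem_merged_components.
case/andP=> hC /subsetP sCD /andP[_ /subsetP sCD'] /andP[_ hD] /andP[_ hD'].
have /card_gt0P[x xC] := component_gt0 _ _ _ hC.
exact: component_inj hD hD' (sCD _ xC) (sCD' _ xC).
Qed.

Lemma merged_groups_sub : {subset flatten merged_groups <= components e}.
Proof.
by move=> C /flatten_mapP[D _]; apply: components_in_sub.
Qed.

(** The ends of an edge of [e'] share a component [D] of [e']. If [D] is a component of [e], it is a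
    clique there; otherwise it is the union of one merged group. Conversely, [D] is a clique of
    [e']. *)
Lemma merge_merged_groups : irreflexive e' ->
  cluster_graph e -> cluster_graph e' -> e' =2 merge_components e merged_groups.
Proof.
move=> e'_irr cl cl' x y /=; apply/idP/orP => [exy|[/sub_e //|]]; last first.
  case/andP=> nxy /hasP[_ /mapP[D hD ->]].
  move: hD; rewrite mem_merged_components => /andP[_ hD].
  by rewrite bigcup_components_in // => /andP[xD yD]; apply: (cl' D).
have nxy : x != y by apply: contraTneq exy => ->; rewrite e'_irr.
have hD := component_of _ e' x; set D := [set z | _] in hD.
have xD : x \in D by rewrite inE.
have yD : y \in D by rewrite inE connect1.
case: (boolP (D \in components e)) => De; first by left; apply: (cl D).
right; rewrite nxy; apply/hasP; exists (components_in e D).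
  by rewrite map_f // mem_merged_components De.
by rewrite /= bigcup_components_in // xD yD.
Qed.

Lemma components_in_cards_gt0 D :
  all (leq 1) [seq #|C| | C : {set T} <- components_in e D].
Proof.
apply/allP=> _ /mapP[C hC ->]; apply: component_gt0.
exact: components_in_sub hC.
Qed.

Lemma merged_partition_family :
  partition_family [seq #|D| | D : {set T} <- merged_components]
    [seq [seq #|C| | C : {set T} <- Gi] | Gi <- merged_groups].
Proof.
split=> [|i]; rewrite !size_map // => lti.
rewrite -map_comp !(nth_map set0) //=; have := mem_nth set0 lti.
set D := nth _ _ _; rewrite mem_merged_components => /andP[_ hD].
by rewrite /is_partition components_in_cards_gt0 sumn_components_in // (component_gt0 _ e') /=.
Qed.

End Supergraph.

Arguments merged_components {T} e e'.
Arguments merged_groups {T} e e'.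

(** * Bounding the total [spp] by the number of added edges *)

Section AddEdges.
Variables (T : finType) (e : rel T) (F : {set {set T}}).
Hypotheses (e_sym : symmetric e) (F_pairs : F \subset vertex_pairs T).
Local Notation e' := (add_edges e F).

Lemma add_edges_sym : symmetric e'.
Proof. by move=> x y; rewrite /add_edges /= e_sym setUC. Qed.

Lemma add_edges_irr : irreflexive e -> irreflexive e'.
Proof.
move=> e_irr x; rewrite /add_edges /= e_irr; apply/negP=> /(subsetP F_pairs).
by rewrite inE setUid cards1.
Qed.

Lemma sub_add_edges : subrel e e'.
Proof. by move=> x y exy; rewrite /add_edges /= exy. Qed.

Lemma sum_spp_merged : cluster_graph e' ->
  \sum_(D <- merged_components e e')
     spp [seq #|C| | C : {set T} <- components_in e D] <= #|F|.
Proof.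
move=> cl'.
(* Double counting of the incidences [f \subset D]. *)
apply: (@leq_trans (\sum_(D <- merged_components e e') \sum_(f in F) (f \subset D))).
  rewrite big_seq [leqRHS]big_seq; apply: leq_sum => D.
  rewrite mem_merged_components => /andP[_ hD].
  have -> : \sum_(f in F) (f \subset D) = #|[set f in F | f \subset D]|.
    by rewrite -sum1dep_card big_mkcondr.
  rewrite -[in X in _ <= X](bigcup_components_in _ e e' add_edges_sym sub_add_edges _ hD).
  apply: spp_le_cross_pairs => //; first exact: components_in_uniq.
    exact: components_in_sub.
  (* [x] and [y] are adjacent in the clique [D] of [e'], but not in [e], where their components
     differ; hence the pair is in [F]. *)
  move=> A B x y; rewrite !mem_components_in.
  case/andP=> hA /subsetP sA /andP[hB /subsetP sB] nAB xA yB.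
  have yA : y \notin A.
    by apply: contraNN nAB => yA; rewrite (component_inj _ _ e_sym _ _ _ hA hB yA yB).
  have nxy : x != y by apply: contraNneq yA => <-.
  case/orP: (cl' _ hD x y (sA _ xA) (sB _ yB) nxy) => // exy.
  by rewrite (component_edge _ _ e_sym _ _ _ hA xA exy) in yA.
(* Each [f] is nonempty, so it lies in at most one of the disjoint components [D]. *)
rewrite exchange_big -sum1_card; apply: leq_sum => f fF /=.
rewrite big_enum -big_mkcondr sum1dep_card; apply/card_le1_eqP=> D D'.
rewrite !inE => /andP[/andP[_ hD] /subsetP fD] /andP[/andP[_ hD'] /subsetP fD'].
have /card_gt0P[x xf] : 0 < #|f|.
  by have := subsetP F_pairs f fF; rewrite inE => /eqP->.
exact: (component_inj _ _ add_edges_sym _ _ _ hD' hD (fD' _ xf) (fD _ xf)).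
Qed.

End AddEdges.

Theorem mainTheorem17 (T : finType) (e : rel T)
    (e_sym : symmetric e) (e_irr : irreflexive e)
    (G_cluster : cluster_graph e) (k eta : nat) :
  (exists F : {set {set T}},
     [/\ F \subset vertex_pairs T :\: edges e, #|F| <= k,
         cluster_graph (add_edges e F) & balanced eta (add_edges e F)]) ->
  balanced eta e \/
  exists (l : nat) (X : seq nat) (Xs : seq (seq nat)),
    [/\ 2 <= l <= 2 * k,
        is_partition l X,
        partition_family X Xs,
        Gvalid e (flatten Xs)
      & \sum_(Y <- Xs) spp Y <= k /\
        exists H : rel T, is_completion e X Xs H /\ balanced eta H].
Proof.
case=> F [/subsetDP[F_pairs _] leFk cl' bal'].
set e' := add_edges e F in cl' bal'.
have e'_sym : symmetric e' := add_edges_sym _ _ _ e_sym.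
have sub_e : subrel e e' := sub_add_edges _ _ _.
(* Otherwise [D0] witnesses that something is merged, which later gives [2 <= l]. *)
have [sub|/subsetPn[D0 hD0 nD0]] := boolP (components e' \subset components e).
  by left; apply: balanced_same_components bal' => //; apply/subsetP.
right; set Ds := merged_components e e'.
have spp_le : \sum_(D <- Ds)
    spp [seq #|C| | C : {set T} <- components_in e D] <= k.
  exact: leq_trans (sum_spp_merged _ _ _ e_sym F_pairs cl') leFk.
have DsP D : D \in Ds -> #|D| <= 2 * spp [seq #|C| | C : {set T} <- components_in e D]
                         /\ 2 <= #|D|.
  rewrite mem_merged_components => /andP[nD hD].
  have gt1 := size_components_in _ _ _ e'_sym sub_e _ hD nD.
  rewrite -(sumn_components_in _ _ _ e_sym e'_sym sub_e _ hD); split.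
    by rewrite sumn_le_double_spp ?size_map // components_in_cards_gt0.
  apply: leq_trans gt1 _; rewrite sumnE big_map -sum1_size big_seq [leqRHS]big_seq.
  by apply: leq_sum => C hC; apply: component_gt0 (components_in_sub _ _ _ _ hC).
have l_ge2 : 2 <= sumn [seq #|D| | D : {set T} <- Ds].
  have hD0s : D0 \in Ds by rewrite mem_merged_components nD0.
  have [_ /leq_trans->] // := DsP _ hD0s.
  by rewrite sumnE big_map (big_rem D0) //= leq_addr.
have pfam := merged_partition_family _ _ _ e_sym e'_sym sub_e.
have valid : Gvalid e
    (flatten [seq [seq #|C| | C : {set T} <- Gi] | Gi <- merged_groups e e']).
  exists (flatten (merged_groups e e')); split; last exact: map_flatten.
    exact: merged_groups_uniq.
  exact: merged_groups_sub.
(* [l] counts the vertices of the new components, [X] lists the sizes of these, and each list in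
   [Xs] the sizes of the components of [e] inside one of them. *)
exists (sumn [seq #|D| | D : {set T} <- Ds]), [seq #|D| | D : {set T} <- Ds],
  [seq [seq #|C| | C : {set T} <- Gi] | Gi <- merged_groups e e'].
split=> //.
(* The bound [l <= 2 * k] is the sum over [Ds] of the bounds in [DsP]. *)
- rewrite l_ge2 (leq_trans _ (leq_mul (leqnn 2) spp_le)) // big_distrr /=.
  rewrite sumnE big_map big_seq [leqRHS]big_seq.
  by apply: leq_sum => D /DsP[].
- rewrite /is_partition eqxx andbT (ltnW l_ge2) /=.
  by apply/allP=> _ /mapP[D /DsP[_ D_ge2] ->]; apply: ltnW.
split; first by rewrite !big_map.
exists e'; split=> //; split=> //; exists (merged_groups e e'); split=> //.
- exact: merged_groups_uniq.
- exact: merged_groups_sub.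
- by apply: merge_merged_groups => //; apply: add_edges_irr.
Qed.
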